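(* Let $X$ be a $\mathrm{CAT}(0)$ space. The coconvex topology $\mathcal T_{co}$ and the weak topology $\mathcal T_{\Delta}$ coincide on all bounded subsets of $X$ if and only if the topology $\mathcal T_{co}$ is sequential and sequentially Hausdorff on every closed ball $B_r(x)$ in $X$. This happens if every closed ball $B_r(x)$ in $X$ is Hausdorff with respect to $\mathcal T_{co}$.
   Context: All $\mathrm{CAT}(0)$ spaces are by definition complete and geodesic. A bounded sequence $(x_n)$ in a $\mathrm{CAT}(0)$ space $X$ converges weakly to a point $x\in X$ if for any compact geodesic $c$ in $X$ starting at $x$, the closest-point projections $\mathrm{Proj}_c(x_n)$ of $x_n$ to $c$ converge to $x$. The weak topology $\mathcal T_{\Delta}$ on $X$ is the topology whose closed sets are exactly those subsets $A\subset X$ such that whenever a bounded sequence of points of $A$ converges weakly to a point $x\in X$, one has $x\in A$. (It is the unique sequential topology on $X$ for which a sequence converges to $x$ if and only if it is bounded and converges weakly to $x$.) The coconvex topology $\mathcal T_{co}$ on $X$ is the coarsest topology on $X$ for which all metrically closed, convex subsets of $X$ are closed. Subsets of $X$ carry the subspace topologies of $\mathcal T_{co}$ and $\mathcal T_{\Delta}$, and properties of a topology ''on'' a subset refer to the subspace topology. $B_r(x)$ is the closed metric ball of radius $r$ around $x$. A topology is sequential if a subset is closed whenever it contains every limit point of every sequence of its elements; it is sequentially Hausdorff if any sequence has at most one limit point (i.e. converges to at most one point). *)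

(* Defs.v *)
From HB Require Import structures.
From mathcomp Require Import all_boot all_order all_algebra.
From mathcomp Require Import all_classical all_reals all_analysis.

Set Implicit Arguments.
Unset Strict Implicit.
Unset Printing Implicit Defensive.
Import Order.TTheory GRing.Theory Num.Theory.
Import numFieldNormedType.Exports.

Local Open Scope classical_set_scope.
Local Open Scope ring_scope.

Section MetricNotions.
Context {R : realType} {X : metricType R}.

(* [closed_ball] of the library is the closure of the open ball; this is the
   set of points at distance at most [r]. *)
Definition mball (x : X) (r : R) : set X := [set y | mdist x y <= r].

Definition mbounded (A : set X) : Prop :=
  exists M : R, forall x y, A x -> A y -> mdist x y <= M.

Definition metric_complete : Prop :=
  forall u : nat -> X, cauchy (u @ \oo) -> exists l : X, u @ \oo --> l.

(* Only the values of [c] on [0, l] matter. *)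
Definition is_geodesic (l : R) (c : R -> X) : Prop :=
  0 <= l /\
  forall s t, s \in `[0, l] -> t \in `[0, l] -> mdist (c s) (c t) = `|s - t|.

Definition geod_image (l : R) (c : R -> X) : set X := c @` [set` `[0, l]].

Definition geod_segment (p q : X) (S : set X) : Prop :=
  exists l c, [/\ is_geodesic l c, c 0 = p, c l = q & S = geod_image l c].

Definition geodesic_space : Prop :=
  forall p q : X, exists S, geod_segment p q S.

Definition geod_convex (C : set X) : Prop :=
  forall l c, is_geodesic l c -> C (c 0) -> C (c l) -> geod_image l c `<=` C.

End MetricNotions.
Arguments metric_complete {R} X.
Arguments geodesic_space {R} X.

(* The Euclidean plane; the library's norm on ['rV[R]_2] is the sup norm. *)
Definition edist {R : realType} (a b : 'rV[R]_2) : R :=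
  Num.sqrt (\sum_(i < 2) (a ord0 i - b ord0 i) ^+ 2).

Section CAT0.
Context {R : realType} {X : metricType R}.

(* The sides of the triangle are [S i] = [v i, v (i + 1)], indices mod 3. *)
Definition geodesic_triangle (v : 'I_3 -> X) (S : 'I_3 -> set X) : Prop :=
  forall i, geod_segment (v i) (v (ordS i)) (S i).

Definition comparison_triangle (v : 'I_3 -> X) (v' : 'I_3 -> 'rV[R]_2) : Prop :=
  forall i, edist (v' i) (v' (ordS i)) = mdist (v i) (v (ordS i)).

(* For [x] on the side [S i] of a triangle with comparison triangle [v'], the
   two distances add up to [edist (v' i) (v' (ordS i))], so the two equations
   say that [x'] is the point of the Euclidean segment [v' i, v' (ordS i)] at
   distance [mdist (v i) x] from [v' i]. *)
Definition comparison_point (v : 'I_3 -> X) (v' : 'I_3 -> 'rV[R]_2)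
    (i : 'I_3) (x : X) (x' : 'rV[R]_2) : Prop :=
  edist (v' i) x' = mdist (v i) x /\
  edist x' (v' (ordS i)) = mdist x (v (ordS i)).

Definition cat0_inequality : Prop :=
  forall v S v', geodesic_triangle v S -> comparison_triangle v v' ->
  forall i j x y x' y', S i x -> S j y ->
    comparison_point v v' i x x' -> comparison_point v v' j y y' ->
    mdist x y <= edist x' y'.

End CAT0.
Arguments cat0_inequality {R} X.

Definition CAT0 {R : realType} (X : metricType R) : Prop :=
  [/\ metric_complete X, geodesic_space X & cat0_inequality X].

Section WeakConvergence.
Context {R : realType} {X : metricType R}.

(* If there is no closest point, the value is the junk [x]; in a CAT(0) space
   the closest point on a compact geodesic exists and is unique. *)
Definition closest_point (C : set X) (x : X) : X :=
  xget x [set y | C y /\ forall z, C z -> mdist x y <= mdist x z].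

Definition weakly_cvg (u : nat -> X) (x : X) : Prop :=
  forall l c, is_geodesic l c -> c 0 = x ->
    (fun n => closest_point (geod_image l c) (u n)) @ \oo --> x.

Definition delta_closed (A : set X) : Prop :=
  forall (u : nat -> X) (x : X), (forall n, A (u n)) ->
    mbounded (range u) -> weakly_cvg u x -> A x.

End WeakConvergence.

(* Two copies of [X], carrying the weak and the coconvex topology. *)
Definition delta_space {R : realType} (X : metricType R) : Type := X.
Definition coconvex_space {R : realType} (X : metricType R) : Type := X.

Section DeltaTopology.
Context {R : realType} {X : metricType R}.

Definition delta_open : set_system (delta_space X) :=
  [set U | delta_closed (~` U : set X)].

Let delta_openT : delta_open setT.
Proof. by move=> u x /(_ 0%N); rewrite setCT. Qed.

Let delta_closed_frequently (A : set X) (u : nat -> X) (x : X) :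
  delta_closed A -> mbounded (range u) -> weakly_cvg u x ->
  (forall N, exists n, (N <= n)%N /\ A (u n)) -> A x.
Proof.
move=> clA [M uM] ux /choice[f fP].
have foo : f @ \oo --> \oo.
  move=> S [N _ NS]; exists N => // n /= Nn; apply: NS => /=.
  exact: leq_trans Nn (fP n).1.
apply: (clA (u \o f) x) => [n||l c gc c0]; first exact: (fP n).2.
- by exists M => _ _ [m _ <-] [n _ <-]; apply: uM; [exists (f m)|exists (f n)].
- exact: (cvg_comp _ _ foo (ux l c gc c0)).
Qed.

Let delta_openI : setI_closed delta_open.
Proof.
move=> A B oA oB u x uAB ub ux [Ax Bx].
have [Afreq|] := pselect (forall N, exists n, (N <= n)%N /\ (~` A) (u n)).
  exact: (delta_closed_frequently oA ub ux Afreq).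
move=> /existsNP[N /forallNP NA].
apply: (delta_closed_frequently oB ub ux) Bx => M.
exists (maxn N M); split; first exact: leq_maxr.
move=> Bu; apply: (uAB (maxn N M)); split => //.
by apply: contrapT => Au; apply: (NA (maxn N M)); split => //; exact: leq_maxl.
Qed.

Let delta_open_bigU (I : Type) (f : I -> set (delta_space X)) :
  (forall i, delta_open (f i)) -> delta_open (\bigcup_i f i).
Proof.
move=> fo u x uf ub ux [i _ fix_]; apply: (fo i u x _ ub ux) => // n fiun.
by apply: (uf n); exists i.
Qed.

HB.instance Definition _ := Choice.on (delta_space X).
HB.instance Definition _ := isOpenTopological.Build (delta_space X)
  delta_openT delta_openI delta_open_bigU.

End DeltaTopology.

Section CoconvexTopology.
Context {R : realType} {X : metricType R}.

Definition coconvex_subbase : set_system (coconvex_space X) :=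
  [set U | closed (~` U : set X) /\ geod_convex (~` U : set X)].

HB.instance Definition _ := Choice.on (coconvex_space X).
HB.instance Definition _ :=
  isSubBaseTopological.Build (coconvex_space X) coconvex_subbase id.

End CoconvexTopology.

Definition sequential_space (T : topologicalType) : Prop :=
  forall A : set T,
    (forall (u : nat -> T) (x : T),
      (forall n, A (u n)) -> u @ \oo --> x -> A x) ->
    closed A.

Definition sequentially_hausdorff (T : topologicalType) : Prop :=
  forall (u : nat -> T) (x y : T), u @ \oo --> x -> u @ \oo --> y -> x = y.

(* The subset [A] of [X], with the subspace topology of the coconvex, resp.
   weak, topology. *)
Definition coconvex_on {R : realType} {X : metricType R} (A : set X) :
    topologicalType := set_type (A : set (coconvex_space X)).
Definition delta_on {R : realType} {X : metricType R} (A : set X) :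
    topologicalType := set_type (A : set (delta_space X)).

(* Both sides are systems of subsets of the same type [set_type A]. *)
Definition topologies_coincide_on {R : realType} {X : metricType R}
    (A : set X) : Prop :=
  (@open (coconvex_on A) : set_system (set_type A)) = @open (delta_on A).

(* Main.v *)
(* In a CAT(0) space every bounded sequence has a weakly convergent subsequence:
   pass to a subsequence all of whose subsequences have the same asymptotic
   radius; its asymptotic center is then the weak limit.  Closed convex sets are
   closed under weak limits, since the projection p of x to such a set C is the
   closest point to each u in C on the geodesic [x, p].  Hence T_co is coarser
   than T_Delta and weak convergence implies T_co-convergence.

   If T_co is sequential and sequentially Hausdorff on a ball, a T_co-limit of a
   sequence in a Delta-closed set is the weak limit of a subsequence.

   If T_co is Hausdorff on a ball, suppose w lies in the T_co-closure of a
   Delta-closed set F but not in F.  To every metric ball of radius 1/(k+1) that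
   is contained in a T_co-open set V disjoint from some T_co-neighborhood U of w,
   attach such a pair (U, V).  Build a countable set S that is closed under
   midpoints and contains, for any finite family of balls centered in S, a point
   of F lying in all the corresponding U.  Enumerating these balls gives a
   sequence in F that eventually stays in every U.  A weak subsequential limit z
   lies in F and in the closure of S, hence in one of these balls, and then the
   subsequence enters the corresponding V, a contradiction. *)
Require Import Defs.
From mathcomp Require Import all_boot all_order all_algebra.
From mathcomp Require Import all_classical all_reals all_analysis.
From mathcomp Require Import ring lra.

Set Implicit Arguments.
Unset Strict Implicit.
Unset Printing Implicit Defensive.
Import Order.TTheory GRing.Theory Num.Theory.
Import numFieldNormedType.Exports.

Local Open Scope classical_set_scope.
Local Open Scope ring_scope.

(** * Euclidean comparison *)

Section Comparison.
Context {R : realType}.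

Definition plane_point (x y : R) : 'rV[R]_2 :=
  \row_(i < 2) (if i == ord0 then x else y).

Lemma edist_plane_point (x y x' y' : R) :
  Defs.edist (plane_point x y) (plane_point x' y') =
  Num.sqrt ((x - x') ^+ 2 + (y - y') ^+ 2).
Proof. by rewrite /Defs.edist 2!big_ord_recl big_ord0 addr0 !mxE. Qed.

Context {X : metricType R}.
Implicit Types (p q z : X).

Lemma geodesic_endpoint_dist (l : R) (c : R -> X) :
  is_geodesic l c -> mdist (c 0) (c l) = l.
Proof.
move=> [l0 gc]; rewrite gc ?in_itv/= ?lexx ?l0// sub0r normrN ger0_norm//.
Qed.

(** By Stewart's theorem the right-hand side is the exact squared distance in the comparison
    triangle. *)
Lemma cat0_stewart (l : R) (c : R -> X) (z : X) (t : R) :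
  CAT0 X -> is_geodesic l c -> 0 <= t <= 1 ->
  mdist z (c (t * l)) ^+ 2 <= (1 - t) * mdist z (c 0) ^+ 2 +
    t * mdist z (c l) ^+ 2 - t * (1 - t) * l ^+ 2.
Proof.
move=> [_ gX cat] gc /andP[t0 t1].
have [l0 cE] := gc.
have [->|lN0] := eqVneq l 0.
  by rewrite mulr0 expr0n/= mulr0 subr0 -mulrDl subrK mul1r.
have lp : 0 < l by rewrite lt_neqAle eq_sym lN0.
have cl := geodesic_endpoint_dist gc.
set a := mdist z (c 0); set b := mdist z (c l).
have a0 : 0 <= a by exact: mdist_ge0.
have b0 : 0 <= b by exact: mdist_ge0.
have ab1 : l <= a + b by rewrite -[leLHS]cl /a (metric_sym z) metric_triangle.
have ab2 : a <= b + l by rewrite -[X in b + X]cl (metric_sym (c 0)) metric_triangle.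
have ab3 : b <= a + l by rewrite -[X in a + X]cl metric_triangle.
(* The base of the comparison triangle lies on the first axis; by the law of cosines [x] is the
   abscissa of the vertex for [z]. *)
pose x := (a ^+ 2 + l ^+ 2 - b ^+ 2) / (2 * l).
have xl : 2 * x * l = a ^+ 2 + l ^+ 2 - b ^+ 2 by rewrite /x; field.
(* The difference of squares factors as in Heron's formula, with factors nonnegative by the triangle
   inequalities; so the height [y] is real. *)
have xa : x ^+ 2 <= a ^+ 2.
  have h : (2 * x * l) ^+ 2 <= (2 * a * l) ^+ 2.
    rewrite xl -subr_ge0.
    rewrite [leRHS](_ : _ = ((b + l - a) * (b + a - l)) * ((a + l - b) * (a + l + b))).
      by rewrite !mulr_ge0//; lra.
    by ring.
  have e u : (2 * u * l) ^+ 2 = u ^+ 2 * (2 * l) ^+ 2 by ring.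
  by rewrite !e ler_pM2r// in h; rewrite exprn_gt0// mulr_gt0.
pose y := Num.sqrt (a ^+ 2 - x ^+ 2).
have yE : y ^+ 2 = a ^+ 2 - x ^+ 2 by rewrite sqr_sqrtr// subr_ge0.
have [S1 S1P] := gX (c l) z; have [S2 S2P] := gX z (c 0).
pose v (i : 'I_3) := match val i with 0%N => c 0 | 1%N => c l | _ => z end.
pose v' (i : 'I_3) := match val i with
  0%N => plane_point 0 0 | 1%N => plane_point l 0 | _ => plane_point x y end.
pose S (i : 'I_3) :=
  match val i with 0%N => geod_image l c | 1%N => S1 | _ => S2 end.
have tl : t * l \in `[0, l] by rewrite in_itv/= mulr_ge0//= ger_pMl.
have trS : geodesic_triangle v S.
  move=> [[|[|[|//]]] i3]; rewrite /v /S/=; [|exact: S1P|exact: S2P].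
  by exists l, c.
have d12 : Defs.edist (plane_point l 0) (plane_point x y) = b.
  rewrite edist_plane_point sub0r sqrrN yE -[RHS](ger0_norm b0) -sqrtr_sqr.
  by congr Num.sqrt; lra.
have cmp : comparison_triangle v v'.
  move=> [[|[|[|//]]] i3]; rewrite /v /v'/=.
  - rewrite edist_plane_point cl subr0 sub0r sqrrN expr0n/= addr0 sqrtr_sqr.
    by rewrite ger0_norm.
  - by rewrite d12 /b metric_sym.
  - by rewrite edist_plane_point !subr0 yE subrKC sqrtr_sqr ger0_norm.
have z1 : S (Ordinal (isT : 1 < 3)%N) z.
  have [l' [c' [[l'0 _] _ c'l' S1E]]] := S1P.
  by rewrite /S/= S1E; exists l' => //=; rewrite in_itv/= l'0/=.
have zc : S ord0 (c (t * l)) by exists (t * l).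
have cz : comparison_point v v' (Ordinal (isT : 1 < 3)%N) z (plane_point x y).
  split; first by rewrite /v /v'/= d12 /b metric_sym.
  by rewrite /v /v'/= mdistxx edist_plane_point !subrr expr0n/= addr0 sqrtr0.
have ct : comparison_point v v' ord0 (c (t * l)) (plane_point (t * l) 0).
  rewrite /comparison_point /v /v'/=.
  rewrite !edist_plane_point subrr expr0n/= !addr0 !sqrtr_sqr.
  by rewrite !cE// in_itv/= lexx l0.
have := cat v S v' trS cmp _ _ _ _ _ _ z1 zc cz ct.
rewrite edist_plane_point subr0 yE => h.
have d0 : 0 <= (x - t * l) ^+ 2 + (a ^+ 2 - x ^+ 2).
  by rewrite -yE addr_ge0// sqr_ge0.
rewrite -(@ler_pXn2r _ 2%N)// ?nnegrE ?sqrtr_ge0 ?mdist_ge0// in h.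
rewrite (le_trans h)// sqr_sqrtr//.
rewrite (_ : (x - t * l) ^+ 2 + (a ^+ 2 - x ^+ 2) =
  a ^+ 2 - t * (2 * x * l) + t ^+ 2 * l ^+ 2); last by ring.
rewrite xl; lra.
Qed.

End Comparison.

(** * Midpoint-convex sets and projections *)

(* [metric_sym] and [metric_triangle] elaborate [mdist] along another coercion
   path from [realType] to [numDomainType], which [lra] does not identify. *)
Lemma mdistC (R : realType) (X : metricType R) (x y : X) :
  mdist x y = mdist y x.
Proof. exact: metric_sym. Qed.

Lemma mdist_triangle (R : realType) (X : metricType R) (x y z : X) :
  mdist x z <= mdist x y + mdist y z.
Proof. exact: metric_triangle. Qed.

Section Minimizers.
Context {R : realType} {X : metricType R}.
Implicit Types (a b m p q x y z : X) (C : set X).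

(** The CN inequality of Bruhat and Tits. At [z = a] and [z = b] it forces [m] to be a midpoint, so
    midpoints can be handled without geodesics. *)
Definition cat0_midpoint a b m := forall z,
  mdist z m ^+ 2 <= (mdist z a ^+ 2 + mdist z b ^+ 2) / 2 - mdist a b ^+ 2 / 4.

(** This form of convexity also makes sense for countable sets, which contain no nontrivial
    geodesic. *)
Definition midconvex C := forall a b, C a -> C b ->
  exists2 m, C m & cat0_midpoint a b m.

Lemma geodesic_midpoint (l : R) (c : R -> X) :
  CAT0 X -> is_geodesic l c -> cat0_midpoint (c 0) (c l) (c (l / 2)).
Proof.
move=> hX gc z; have h : 0 <= (2^-1 : R) <= 1 by lra.
have := cat0_stewart z hX gc h; rewrite (geodesic_endpoint_dist gc) mulrC; lra.
Qed.

Lemma geod_convex_midconvex C : CAT0 X -> geod_convex C -> midconvex C.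
Proof.
move=> hX cC a b Ca Cb; have [_ gX _] := hX.
have [S [l [c [gc c0 cl _]]]] := gX a b; subst a b.
exists (c (l / 2)); last exact: geodesic_midpoint.
have [l0 _] := gc; apply: cC gc Ca Cb _ _; exists (l / 2) => //=.
by rewrite in_itv/=; lra.
Qed.

Lemma midpoint_exists a b : CAT0 X -> exists m, cat0_midpoint a b m.
Proof.
by move=> hX; have [|m _] := @geod_convex_midconvex setT hX _ a b I I; [|exists m].
Qed.

Lemma midpoint_distl a b m : cat0_midpoint a b m -> mdist a m <= mdist a b / 2.
Proof.
move=> /(_ a); rewrite mdistxx expr0n/= => h.
rewrite -(@ler_pXn2r _ 2%N)// ?nnegrE ?mdist_ge0//; last first.
  by rewrite divr_ge0 ?mdist_ge0.
by rewrite expr_div_n; lra.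
Qed.

Lemma midpoint_sym a b m : cat0_midpoint a b m -> cat0_midpoint b a m.
Proof. by move=> h z; have := h z; rewrite (mdistC b a); lra. Qed.

Lemma mball_midconvex x (r : R) : CAT0 X -> 0 <= r -> midconvex (mball x r).
Proof.
move=> hX r0 a b; rewrite /mball/= => ra rb; have [m abm] := midpoint_exists a b hX.
exists m => //.
rewrite -(@ler_pXn2r _ 2%N)// ?nnegrE ?mdist_ge0//.
have {}ra : mdist x a ^+ 2 <= r ^+ 2 by rewrite ler_pXn2r ?nnegrE ?mdist_ge0.
have {}rb : mdist x b ^+ 2 <= r ^+ 2 by rewrite ler_pXn2r ?nnegrE ?mdist_ge0.
by have := abm x; have := sqr_ge0 (mdist a b); lra.
Qed.

(** [P y r] reads: the function to be minimized is at most [r] at [y]. The midpoint hypothesis is a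
    uniform convexity that makes minimizing sequences Cauchy. The conclusion has [r + e] because an
    eventual bound along a sequence may fail at the infimum itself. *)
Lemma approx_minimizer (P : X -> R -> Prop) : metric_complete X ->
  (exists y r, P y r) ->
  (forall y r, P y r -> 0 <= r) ->
  (forall y r s, P y r -> r <= s -> P y s) ->
  (forall y y' r, P y r -> P y' r ->
     exists m s, P m s /\ s ^+ 2 <= r ^+ 2 - mdist y y' ^+ 2 / 4) ->
  (forall y r, (forall e, 0 < e -> exists2 y', mdist y y' < e & P y' (r + e)) ->
     forall e, 0 < e -> P y (r + e)) ->
  exists x r, (forall e, 0 < e -> P x (r + e)) /\ forall y s, P y s -> r <= s.
Proof.
move=> cX [y0 [r0 Pyr0]] P0 Pmon Pmid Pcl.
pose E := [set s | exists y, P y s].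
have Elb : has_lbound E by exists 0 => s [y /P0].
have Einf : has_inf E by split => //; exists r0, y0.
pose r := inf E.
have rlb y s : P y s -> r <= s by move=> Pys; apply: ge_inf => //; exists y.
have rge0 : 0 <= r by apply: lb_le_inf; [exists r0, y0|move=> s [y /P0]].
have app n : exists y, P y (r + n.+1%:R^-1).
  have n0 : 0 < n.+1%:R^-1 :> R by rewrite invr_gt0.
  have [s [y Pys] sr] := inf_adherent n0 Einf.
  by exists y; apply: Pmon Pys _; exact: ltW.
have [u uP] := choice app.
(* The value at the midpoint is at least the infimum [r]. *)
have close y y' s : P y s -> P y' s -> mdist y y' ^+ 2 <= 4 * (s ^+ 2 - r ^+ 2).
  move=> Py Py'; have [m [t [Pmt ts]]] := Pmid _ _ _ Py Py'.
  have rt := rlb _ _ Pmt.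
  have rt2 : r ^+ 2 <= t ^+ 2 by rewrite ler_pXn2r// ?nnegrE// (le_trans rge0).
  by lra.
have small (e : R) : 0 < e -> exists2 N, 0 < (N.+1%:R^-1 : R) < e &
    forall n y, (N <= n)%N -> P y (r + N.+1%:R^-1) -> mdist y (u n) < e.
  (* For [d] below both [1] and [e ^+ 2 / (8 * (2 * r + 1))], the bound
     [4 * ((r + d) ^+ 2 - r ^+ 2)] is at most [4 * d * (2 * r + 1)], hence below [e ^+ 2]. *)
  move=> e0; pose e' := Num.min (e / 2) (Num.min 1 (e ^+ 2 / (8 * (2 * r + 1)))).
  have e'0 : 0 < e'.
    rewrite !lt_min ltr01 divr_gt0//= divr_gt0 ?exprn_gt0// mulr_gt0//.
    by rewrite ltr_wpDl// mulr_ge0.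
  have [N NP] := ltr_add_invr e'0; rewrite add0r in NP.
  have N0 : 0 < N.+1%:R^-1 :> R by rewrite invr_gt0.
  have e'e : e' < e by rewrite gt_min; apply/orP; left; lra.
  exists N. 
  apply/andP; split; [exact: N0|exact: lt_trans e'e].
  move=> n y Nn Py.
  have Pn : P (u n) (r + N.+1%:R^-1).
    by apply: Pmon (uP n) _; rewrite lerD2l lef_pV2 ?posrE ?ltr0n// ler_nat.
  have := close _ _ _ Py Pn; set d := N.+1%:R^-1 in NP N0 * => h.
  have d1 : d < 1 by rewrite (lt_le_trans NP)// !ge_min lexx orbT.
  have d2 : d < e ^+ 2 / (8 * (2 * r + 1)).
    by rewrite (lt_le_trans NP)// !ge_min lexx !orbT.
  rewrite ltr_pdivlMr in d2; last by rewrite mulr_gt0// ltr_wpDl// mulr_ge0.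
  rewrite -(@ltr_pXn2r _ 2%N)// ?nnegrE ?mdist_ge0// 1?ltW//.
  by rewrite (le_lt_trans h)//; nra.
have cu : cauchy (u @ \oo).
  apply: cauchy_exP => e e0; have [N _ NP] := small e e0.
  exists (u N); rewrite /= ballEmdist; exists N => // n /= Nn.
  exact: NP.
have [x ux] := cX _ cu.
exists x, r; split => //.
apply: Pcl => e e0; have [N /andP[N0 Ne] NP] := small e e0.
have [M _ MP] := metricType_numDomainType.cvgr_dist_lt ux e0.
exists (u (maxn M N)); first by apply: MP => /=; exact: leq_maxl.
apply: Pmon (uP _) _; rewrite lerD2l (le_trans _ (ltW Ne))//.
by rewrite lef_pV2 ?posrE ?ltr0n// ler_nat ltnS leq_maxr.
Qed.

Lemma closed_mdistP C : closed C <->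
  forall x, (forall e, 0 < e -> exists2 y, C y & mdist x y < e) -> C x.
Proof.
split=> [cC x xC|h x xC].
  apply: cC => B /metricType_numDomainType.nbhs_mdistP[e /= e0 eB].
  by have [y Cy xy] := xC e e0; exists y; split => //; exact: eB.
apply: h => e e0; have [|y [Cy ?]] := xC [set y | mdist x y < e]; last by exists y.
by apply/metricType_numDomainType.nbhs_mdistP; exists e.
Qed.

Lemma closest_point_spec C z : metric_complete X ->
  closed C -> midconvex C -> C !=set0 ->
  C (closest_point C z) /\
  forall q, C q -> mdist z (closest_point C z) <= mdist z q.
Proof.
move=> cX clC mC [c Cc].
suff [p pP] : exists p, C p /\ forall q, C q -> mdist z p <= mdist z q.
  by rewrite /closest_point; case: xgetP => [y _ []//|/(_ p)[]].
pose P y r := [/\ 0 <= r, C y & mdist z y <= r].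
have [| | | | |x [r [xr rP]]] := approx_minimizer (P := P) cX.
- by exists c, (mdist z c); split => //; exact: mdist_ge0.
- by move=> y r [].
- by move=> y r s [r0 Cy zy] rs; split => //; apply: le_trans rs.
- move=> y y' r [r0 Cy zy] [_ Cy' zy']; have [m Cm mm] := mC _ _ Cy Cy'.
  exists m, (mdist z m); split; first by split => //; exact: mdist_ge0.
  apply: le_trans (mm z) _; rewrite lerD2r.
  have {}zy : mdist z y ^+ 2 <= r ^+ 2 by rewrite ler_pXn2r ?nnegrE ?mdist_ge0.
  have {}zy' : mdist z y' ^+ 2 <= r ^+ 2 by rewrite ler_pXn2r ?nnegrE ?mdist_ge0.
  lra.
- move=> y r yr e e0; have e20 : 0 < e / 2 by rewrite divr_gt0.
  have [y' yy' [re0 _ zy']] := yr _ e20.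
  split; first lra.
  + apply: (closed_mdistP C).1 => // d /yr[y'' yy'' [_ Cy'' _]].
    by exists y''.
  + have := mdist_triangle z y' y; rewrite (mdistC y' y); lra.
exists x; have [_ Cx _] := xr 1 ltr01; split => // q Cq.
apply: le_trans (rP q (mdist z q) _); last by split => //; exact: mdist_ge0.
by apply/ler_addgt0Pr => e /xr[].
Qed.

(** A Pythagorean inequality: the angle at a closest point is at least a right angle. *)
Lemma projection_obtuse C p q u : midconvex C -> C p -> C u ->
  (forall w, C w -> mdist q p <= mdist q w) ->
  mdist q p ^+ 2 + mdist p u ^+ 2 <= mdist q u ^+ 2.
Proof.
move=> mC Cp Cu pmin.
(* Bisecting the segment from [p] to [w] doubles the precision of the bound. *)
have half k : forall w, C w ->
    (1 - 2^-1 ^+ k) * mdist p w ^+ 2 <= mdist q w ^+ 2 - mdist q p ^+ 2.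
  elim: k => [w Cw|k IH w Cw].
    rewrite expr0 subrr mul0r subr_ge0 ler_pXn2r ?nnegrE ?mdist_ge0//.
    exact: pmin.
  have [m Cm mm] := mC _ _ Cp Cw.
  have h1 := mm q; have h2 := IH m Cm.
  have h3 : mdist p w <= 2 * mdist p m.
    have t1 := mdist_triangle p m w.
    have t2 := midpoint_distl (midpoint_sym mm).
    rewrite (mdistC w p) (mdistC w m) in t2; lra.
  have {}h3 : mdist p w ^+ 2 <= (2 * mdist p m) ^+ 2.
    by rewrite ler_pXn2r ?nnegrE ?mulr_ge0 ?mdist_ge0.
  have k1 : 0 <= 1 - 2^-1 ^+ k :> R.
    by rewrite subr_ge0 exprn_ile1//; lra.
  have := ler_wpM2l k1 h3; rewrite exprMn (exprS _ k); lra.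
rewrite -lerBrDl; apply/ler_addgt0Pr => e e0.
set D := mdist p u ^+ 2; have D0 : 0 <= D by exact: sqr_ge0.
have D1 : 0 < D + 1 by lra.
have [N _ /(_ N (leqnn N))/=] :=
  near_infty_natSinv_expn_lt (PosNum (divr_gt0 e0 D1)).
rewrite div1r -exprVn ltr_pdivlMr// => h.
have := half N u Cu; rewrite -/D.
have N0 : 0 <= 2^-1 ^+ N :> R by rewrite exprn_ge0 ?invr_ge0.
nra.
Qed.

End Minimizers.

(** * Weak limits *)

Section WeakLimits.
Context {R : realType} {X : metricType R}.
Implicit Types (a b m p q x y z : X) (C : set X) (u : nat -> X).

Lemma subgeodesic (l s t : R) (c : R -> X) : is_geodesic l c ->
  0 <= s -> s <= t -> t <= l -> is_geodesic (t - s) (fun w => c (s + w)).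
Proof.
move=> [l0 gc] s0 st tl; split; first lra.
move=> v w; rewrite !in_itv/= => /andP[v0 vt] /andP[w0 wt].
rewrite gc ?in_itv/=; [|lra..].
by congr `|_|; lra.
Qed.

Lemma geodesic_reverse (l : R) (c : R -> X) : is_geodesic l c ->
  is_geodesic l (fun w => c (l - w)).
Proof.
move=> [l0 gc]; split => // v w; rewrite !in_itv/= => /andP[v0 vt] /andP[w0 wt].
rewrite gc ?in_itv/=; [|lra..].
by rewrite distrC; congr `|_|; lra.
Qed.

Lemma geod_image_reverse (l : R) (c : R -> X) :
  geod_image l (fun w => c (l - w)) = geod_image l c.
Proof.
apply/seteqP; split => _ [t tl <-]; move: tl; rewrite /= in_itv/= => tl.
  by exists (l - t) => //=; rewrite in_itv/=; lra.
by exists (l - t); rewrite /= ?in_itv/= ?subKr//; lra.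
Qed.

Lemma geod_image_midconvex (l : R) (c : R -> X) :
  CAT0 X -> is_geodesic l c -> midconvex (geod_image l c).
Proof.
move=> hX gc _ _ [s sl <-] [t tl <-].
wlog st : s t sl tl / s <= t => [H|].
  have [st|/ltW ts] := leP s t; first exact: H.
  by have [m Cm mm] := H t s tl sl ts; exists m => //; exact: midpoint_sym.
move: sl tl => /=; rewrite !in_itv/= => /andP[s0 sl] /andP[t0 tl].
exists (c (s + (t - s) / 2)); first by exists (s + (t - s) / 2) => //=; rewrite in_itv/=; lra.
have := geodesic_midpoint hX (subgeodesic gc s0 st tl).
by rewrite addr0 subrKC.
Qed.

Lemma geod_image_closed (l : R) (c : R -> X) :
  is_geodesic l c -> closed (geod_image l c).
Proof.
move=> [l0 gc].
(* Nothing is known of [c] outside [[0, l]]; composing with the 1-Lipschitz retraction [k] gives a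
   map continuous on the whole line. *)
pose k t := Num.max 0 (Num.min l t).
have kl t : 0 <= k t <= l by rewrite /k le_max lexx/= ge_max l0 ge_min lexx.
have kE t : 0 <= t <= l -> k t = t.
  by move=> /andP[t0 tl]; rewrite /k min_r// max_r.
have klip s t : `|k s - k t| <= `|s - t|.
  rewrite /k /Num.max /Num.min.
  by do ! case: ifPn; rewrite -?leNgt; move=> *; rewrite ler_norml;
     have := ler_norm (s - t); have := ler_norm (t - s); rewrite (distrC t);
     lra.
have kc : continuous (c \o k : R -> X).
  move=> t; apply/metricType_numDomainType.cvgrPdist_lt => e e0; near=> s.
  have : `|t - s| < e by near: s; exact: cvgr_dist_lt.
  by apply: le_lt_trans; rewrite /= gc ?in_itv/= ?kl.
have -> : geod_image l c = (c \o k) @` [set` `[0, l]].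
  apply/seteqP; split => _ [t tl <-]; exists t => //=;
  by rewrite kE//; move: tl; rewrite /= in_itv.
apply: compact_closed; first exact: metric_hausdorff.
apply: continuous_compact; last exact: segment_compact.
exact: continuous_subspaceT.
Unshelve. all: by end_near. Qed.

Lemma closest_geod_image (l : R) (c : R -> X) z : CAT0 X -> is_geodesic l c ->
  geod_image l c (closest_point (geod_image l c) z) /\
  forall t, 0 <= t <= l ->
    mdist z (closest_point (geod_image l c) z) <= mdist z (c t).
Proof.
move=> hX gc; have [cX _ _] := hX.
have [|pC pmin] := closest_point_spec z cX (geod_image_closed gc)
  (geod_image_midconvex hX gc).
  by have [l0 _] := gc; exists (c 0), 0 => //=; rewrite in_itv/= lexx.
by split => // t tl; apply: pmin; exists t.
Qed.

(** The projections to one geodesic between [x] and [y], parametrized from either end, converge to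
    both points. *)
Lemma weakly_cvg_unique u x y : CAT0 X ->
  weakly_cvg u x -> weakly_cvg u y -> x = y.
Proof.
move=> [_ gX _] ux uy; have [S [l [c [gc c0 cl _]]]] := gX x y.
have := uy l _ (geodesic_reverse gc); rewrite subr0 geod_image_reverse.
move=> /(_ cl); have := ux l c gc c0.
exact: (cvg_unique (@metric_hausdorff _ X)).
Qed.

Lemma cvg_nat_ge (f : nat -> nat) : (forall n, (n <= f n)%N) -> f @ \oo --> \oo.
Proof.
move=> fn S [N _ NS]; exists N => // n /= Nn; apply: NS => /=.
exact: leq_trans Nn (fn n).
Qed.

Lemma weakly_cvg_subseq u x (f : nat -> nat) : (forall n, (n <= f n)%N) ->
  weakly_cvg u x -> weakly_cvg (u \o f) x.
Proof.
by move=> /cvg_nat_ge fn ux l c gc c0; exact: cvg_comp fn (ux l c gc c0).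
Qed.

Lemma mbounded_subseq u (f : nat -> nat) :
  mbounded (range u) -> mbounded (range (u \o f)).
Proof.
by move=> [M uM]; exists M => _ _ [m _ <-] [n _ <-]; apply: uM; [exists (f m)|exists (f n)].
Qed.

Lemma midconvex_delta_closed C : CAT0 X ->
  closed C -> midconvex C -> delta_closed C.
Proof.
move=> hX clC mC u x uC _ ux; apply: contrapT => Cx.
have [cX gX _] := hX.
have [|pC pmin] := closest_point_spec x cX clC mC; first by exists (u 0%N).
set p := closest_point C x in pC pmin.
have [S [l [c [gc c0 cl _]]]] := gX x p.
have [l0 cE] := gc.
(* The projection [q] of [u n] lies on [[x, p]], so [p] is also closest to [q] in [C]; the
   Pythagorean inequality and the minimality of [q] then force [q = p]. *)
have imp n : closest_point (geod_image l c) (u n) = p.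
  have [qC h] := closest_geod_image (u n) hX gc.
  set q := closest_point _ _ in qC h *; have [t tl tq] := qC; rewrite -tq in h *.
  have {}h : mdist (u n) (c t) <= mdist (u n) (c l) by apply: h; rewrite l0/=.
  move: (tl); rewrite /= in_itv/= => /andP[t0 tl'].
  have qp : mdist (c t) p = l - t.
    by rewrite -cl cE ?in_itv/= ?l0 ?lexx// distrC ger0_norm// subr_ge0.
  have xq : mdist x (c t) = t.
    by rewrite -c0 cE ?in_itv/= ?l0 ?lexx// sub0r normrN ger0_norm.
  have xp : mdist x p = l by rewrite -c0 -cl (geodesic_endpoint_dist gc).
  have qmin w : C w -> mdist (c t) p <= mdist (c t) w.
    by move=> Cw; have := pmin w Cw; have := mdist_triangle x (c t) w; rewrite xp; lra.
  rewrite cl in h.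
  have {}h : mdist (u n) (c t) ^+ 2 <= mdist (u n) p ^+ 2.
    by rewrite ler_pXn2r ?nnegrE ?mdist_ge0.
  have := projection_obtuse mC pC (uC n) qmin.
  rewrite (mdistC p) (mdistC (c t) (u n)) => h2.
  apply: mdist_positivity; apply/eqP; rewrite -sqrf_eq0 eq_le sqr_ge0 andbT; lra.
have px : p = x.
  have := ux l c gc c0; under eq_fun do rewrite imp.
  exact: (cvg_unique (@metric_hausdorff _ X) (cvg_cst p)).
by apply: Cx; rewrite -px.
Qed.

End WeakLimits.

(** * Weak sequential compactness *)

Section WeakCompactness.
Context {R : realType} {X : metricType R}.
Implicit Types (y : X) (u : nat -> X) (N M : set nat) (a r : R).

(* Subsequences are encoded by their cofinal sets of indices. *)
Definition cofinal N := forall k, exists2 n, N n & (k <= n)%N.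

(** The condition [0 <= a] keeps the radii bounded below even for finite [N]. *)
Definition ev_within u N y a :=
  0 <= a /\ exists k, forall n, N n -> (k <= n)%N -> mdist y (u n) <= a.

Definition asymptotic_radius u N : R :=
  inf [set a | exists y, ev_within u N y a].

(** For a bounded sequence, fewer indices can only lower the radius, so the inequality amounts to
    equality. *)
Definition regular_seq u := forall N, cofinal N ->
  asymptotic_radius u setT <= asymptotic_radius u N.

Lemma asymptotic_radius_le u N y a :
  ev_within u N y a -> asymptotic_radius u N <= a.
Proof. by move=> h; apply: ge_inf; [exists 0 => ? [? []]|exists y]. Qed.

Lemma mbounded_ev_within u N : mbounded (range u) ->
  exists a, ev_within u N (u 0%N) a.
Proof.
move=> [a ua]; exists a; split.
  by rewrite -(mdistxx (u 0%N)); apply: ua; exists 0%N.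
by exists 0%N => n _ _; apply: ua; [exists 0%N|exists n].
Qed.

Lemma le_asymptotic_radius u v N M : mbounded (range v) ->
  (forall y a, ev_within v M y a -> ev_within u N y a) ->
  asymptotic_radius u N <= asymptotic_radius v M.
Proof.
move=> bv h; apply: lb_le_inf.
  by have [a va] := mbounded_ev_within M bv; exists a, (v 0%N).
by move=> a [y /h]; exact: asymptotic_radius_le.
Qed.

Lemma almost_minimal_radius u N e : mbounded (range u) -> cofinal N -> 0 < e ->
  exists M, [/\ M `<=` N, cofinal M & forall K, K `<=` N -> cofinal K ->
    asymptotic_radius u M <= asymptotic_radius u K + e].
Proof.
move=> bu iN e0.
pose E := [set r | exists M, [/\ M `<=` N, cofinal M & r = asymptotic_radius u M]].
have Elb : has_lbound E.
  exists 0 => _ [M [_ _ ->]]; apply: lb_le_inf; last by move=> a [y []].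
  by have [a ua] := mbounded_ev_within M bu; exists a, (u 0%N).
have Einf : has_inf E by split=> //; exists (asymptotic_radius u N), N; split.
have [_ [M [MN iM ->]] Mlt] := inf_adherent e0 Einf.
exists M; split => // K KN iK; rewrite (le_trans (ltW Mlt))// lerD2r.
by apply: ge_inf => //; exists K.
Qed.

(* Shrink the index set repeatedly so that its radius becomes almost minimal
   among the cofinal subsets, then take a diagonal sequence. *)
Lemma regular_subsequence u : mbounded (range u) ->
  exists f : nat -> nat, (forall n, (n <= f n)%N) /\ regular_seq (u \o f).
Proof.
move=> bu.
have step (p : nat * set nat) : exists M, cofinal p.2 ->
    [/\ M `<=` p.2, cofinal M & forall K, K `<=` p.2 -> cofinal K ->
    asymptotic_radius u M <= asymptotic_radius u K + p.1.+1%:R^-1].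
  have [iN|iN] := pselect (cofinal p.2); last by exists setT.
  have n0 : 0 < p.1.+1%:R^-1 :> R by rewrite invr_gt0.
  by have [M ?] := almost_minimal_radius bu iN n0; exists M.
have [g gP] := choice step.
pose M := fix M k := if k is k'.+1 then g (k', M k') else setT.
have iM k : cofinal (M k).
  by elim: k => [k|k /(gP (k, M k))[]//]; exists k.
have MS k : M k.+1 `<=` M k by have [] := gP (k, M k) (iM k).
have Mle j k : (j <= k)%N -> M k `<=` M j.
  elim: k => [|k IH]; first by rewrite leqn0 => /eqP ->.
  rewrite leq_eqVlt => /orP[/eqP ->//|]; rewrite ltnS => /IH.
  by apply: subset_trans; exact: MS.
have ex k : exists n, M k n /\ (k <= n)%N by have [n Mn kn] := iM k k; exists n.
have [f fP] := choice ex.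
exists f; split => [n|N iN]; first by case: (fP n).
apply/ler_addgt0Pr => e e0.
have [k ke] := ltr_add_invr e0; rewrite add0r in ke.
(* [K] is a cofinal subset of [M k], so the radius on [M k.+1] exceeds that on [K] by at most
   [k.+1%:R^-1], while [f] eventually takes its values in [M k.+1]. *)
pose K := [set n | exists2 j, (N j /\ (k <= j)%N) & n = f j].
have KM : K `<=` M k.
  by move=> _ [j [_ kj] ->]; apply: (Mle _ _ kj); case: (fP j).
have iK : cofinal K.
  move=> n; have [j Nj nj] := iN (maxn n k).
  exists (f j); first by exists j => //; split => //; rewrite (leq_trans _ nj)// leq_maxr.
  by case: (fP j) => _; apply: leq_trans; rewrite (leq_trans _ nj)// leq_maxl.
have [_ _ gmin] := gP (k, M k) (iM k).
have bf := mbounded_subseq f bu.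
rewrite (@le_trans _ _ (asymptotic_radius u (M k.+1)))//.
  apply: (le_asymptotic_radius bu) => y a [a0 [n nP]]; split => //.
  exists (maxn n k.+1) => j _; rewrite geq_max => /andP[nj kj].
  apply: nP; last by case: (fP j) => _; exact: leq_trans.
  by apply: (Mle _ _ kj); case: (fP j).
apply: le_trans (gmin _ KM iK) _; apply: lerD; last exact: ltW.
apply: le_asymptotic_radius => // y a [a0 [n nP]]; split => //.
(* [f] may fail to be monotone; an index above all [f j] with [j < n] can only come from some
   [j >= n]. *)
exists (\max_(j < n) f j).+1 => _ [j [Nj kj] ->] h; apply: nP => //.
rewrite leqNgt; apply/negP => jn; move: h; apply/negP; rewrite -leqNgt.
exact: (@leq_bigmax _ (fun i : 'I_n => f i) (Ordinal jn)).
Qed.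

Lemma asymptotic_center u : CAT0 X -> mbounded (range u) ->
  exists x, forall e, 0 < e -> ev_within u setT x (asymptotic_radius u setT + e).
Proof.
move=> hX bu; have [cX _ _] := hX.
have [| | | | |x [r [xr rP]]] := approx_minimizer (P := ev_within u setT) cX.
- by have [a ua] := mbounded_ev_within setT bu; exists (u 0%N), a.
- by move=> y a [].
- move=> y a b [a0 [k kP]] ab; split; first exact: le_trans ab.
  by exists k => n _ kn; exact: le_trans (kP n I kn) ab.
- move=> y y' a [a0 [k kP]] [_ [k' k'P]]; have [m mP] := midpoint_exists y y' hX.
  have bnd n : (maxn k k' <= n)%N ->
      mdist m (u n) ^+ 2 <= a ^+ 2 - mdist y y' ^+ 2 / 4.
    rewrite geq_max => /andP[kn k'n].
    have := mP (u n); rewrite !(mdistC (u n)).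
    have : mdist y (u n) ^+ 2 <= a ^+ 2.
      by rewrite ler_pXn2r ?nnegrE ?mdist_ge0// kP.
    have : mdist y' (u n) ^+ 2 <= a ^+ 2.
      by rewrite ler_pXn2r ?nnegrE ?mdist_ge0// k'P.
    lra.
  have s0 : 0 <= a ^+ 2 - mdist y y' ^+ 2 / 4.
    by apply: le_trans (bnd _ (leqnn _)); exact: sqr_ge0.
  exists m, (Num.sqrt (a ^+ 2 - mdist y y' ^+ 2 / 4)).
  rewrite sqr_sqrtr//; split => //; split; first exact: sqrtr_ge0.
  exists (maxn k k') => n _ /bnd h.
  by rewrite -(ger0_norm (mdist_ge0 _ _)) -sqrtr_sqr ler_wsqrtr.
- move=> y a h e e0; have e20 : 0 < e / 2 by rewrite divr_gt0.
  have [y' yy' [ae [k kP]]] := h _ e20.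
  split; first by lra.
  exists k => n _ kn; have := kP n I kn; have := mdist_triangle y y' (u n); lra.
exists x => e e0.
suff <- : r = asymptotic_radius u setT by exact: xr.
apply/eqP; rewrite eq_le; apply/andP; split.
  apply: lb_le_inf; last by move=> a [y /rP].
  by have [a ua] := mbounded_ev_within setT bu; exists a, (u 0%N).
by apply/ler_addgt0Pr => d /xr /asymptotic_radius_le.
Qed.

Lemma weakly_cvg_asymptotic_center u x : CAT0 X -> mbounded (range u) ->
  regular_seq u ->
  (forall e, 0 < e -> ev_within u setT x (asymptotic_radius u setT + e)) ->
  weakly_cvg u x.
Proof.
move=> hX bu regu xP l c gc c0.
set r := asymptotic_radius u setT in xP.
have r0 : 0 <= r.
  by apply/ler_addgt0Pr => e /xP[].
apply/metricType_numDomainType.cvgrPdist_lt => e e0; apply: contrapT => nev.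
set p := fun n => closest_point (geod_image l c) (u n) in nev.
pose N := [set n | e <= mdist x (p n)].
have iN : cofinal N.
  move=> k; apply: contrapT => h; apply: nev; exists k => // n /= kn.
  by rewrite ltNge; apply/negP => en; apply: h; exists n.
(* If infinitely many projections stay at distance [e] from [x], then moving
   the center from [x] to [q] lowers the asymptotic radius along them. *)
pose q := c (e / 2).
have qN n : N n -> mdist q (u n) ^+ 2 <= mdist x (u n) ^+ 2 - e ^+ 2 / 2.
  rewrite /N/= /p.
  have [pC pmin] := closest_geod_image (u n) hX gc.
  set pn := closest_point _ _ in pC pmin *; have [t tl tp] := pC.
  move: tl; rewrite /= in_itv/= => /andP[t0 tl] et.
  have [l0 cE] := gc.
  have xt : mdist x pn = t.
    by rewrite -c0 -tp cE ?in_itv/= ?lexx ?l0 ?t0// sub0r normrN ger0_norm.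
  rewrite xt in et.
  have tp0 : 0 < t by exact: lt_le_trans e0 et.
  have gt : is_geodesic t c.
    have := subgeodesic gc (lexx 0) t0 tl; rewrite subr0.
    by under eq_fun do rewrite add0r.
  pose s := e / 2 / t.
  have s0 : 0 < s by rewrite !divr_gt0.
  have s1 : s <= 2^-1 by rewrite /s ler_pdivrMr//; lra.
  have sE : s * t = e / 2 by rewrite /s divfK// gt_eqF.
  have := cat0_stewart (t := s) (u n) hX gt; rewrite sE -/q c0 tp.
  have qle : mdist (u n) pn <= mdist (u n) q by apply: pmin; lra.
  have {}qle : mdist (u n) pn ^+ 2 <= mdist (u n) q ^+ 2.
    by rewrite ler_pXn2r ?nnegrE ?mdist_ge0.
  rewrite !(mdistC (u n)) in qle * => h0.
  have {h0}h : mdist q (u n) ^+ 2 <= (1 - s) * mdist x (u n) ^+ 2 +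
      s * mdist pn (u n) ^+ 2 - s * (1 - s) * t ^+ 2 by apply: h0; lra.
  have st : s * t ^+ 2 = e / 2 * t by rewrite expr2 mulrA sE.
  have et2 : e ^+ 2 / 2 <= e / 2 * t by rewrite expr2; nra.
  (* In Stewart's inequality the distance to [pn] is replaced by the larger distance to [q]; the
     factor [1 - s] then cancels. *)
  suff : (1 - s) * mdist q (u n) ^+ 2 <=
      (1 - s) * (mdist x (u n) ^+ 2 - e / 2 * t).
    by rewrite ler_pM2l; [lra|lra].
  rewrite -st; have := ler_wpM2l (ltW s0) qle; lra.
(* This keeps [(r + d) ^+ 2 - r ^+ 2] at most [e ^+ 2 / 4], less than the gain [e ^+ 2 / 2]. *)
pose d := Num.min 1 (e ^+ 2 / (4 * (2 * r + 1))).
have r1 : 0 < 4 * (2 * r + 1) by lra.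
have d0 : 0 < d by rewrite lt_min ltr01/= divr_gt0// exprn_gt0.
have d1 : d <= 1 by rewrite ge_min lexx.
have d2 : d * (4 * (2 * r + 1)) <= e ^+ 2.
  by rewrite -ler_pdivlMr// ge_min lexx orbT.
have [rd [k kP]] := xP d d0.
have qbnd n : N n -> (k <= n)%N -> mdist q (u n) ^+ 2 <= (r + d) ^+ 2 - e ^+ 2 / 2.
  move=> Nn kn; apply: le_trans (qN n Nn) _; rewrite lerD2r.
  by rewrite ler_pXn2r ?nnegrE ?mdist_ge0// kP.
have s0 : 0 <= (r + d) ^+ 2 - e ^+ 2 / 2.
  have [n Nn kn] := iN k; apply: le_trans (qbnd n Nn kn); exact: sqr_ge0.
have /asymptotic_radius_le : ev_within u N q (Num.sqrt ((r + d) ^+ 2 - e ^+ 2 / 2)).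
  split; first exact: sqrtr_ge0.
  exists k => n Nn /(qbnd n Nn) h.
  by rewrite -(ger0_norm (mdist_ge0 _ _)) -sqrtr_sqr ler_wsqrtr.
move=> /(le_trans (regu N iN)); rewrite -/r => h.
have {}h : r ^+ 2 <= (r + d) ^+ 2 - e ^+ 2 / 2.
  by rewrite -[leRHS]sqr_sqrtr// ler_pXn2r ?nnegrE ?sqrtr_ge0.
have e2 : 0 < e ^+ 2 by rewrite exprn_gt0.
have : d ^+ 2 <= d by rewrite expr2 ger_pMl.
by have : d * r = r * d := mulrC _ _; nra.
Qed.

Lemma weak_sequential_compactness u : CAT0 X -> mbounded (range u) ->
  exists (f : nat -> nat) x, (forall n, (n <= f n)%N) /\ weakly_cvg (u \o f) x.
Proof.
move=> hX bu; have [f [fge regf]] := regular_subsequence bu.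
have bf := mbounded_subseq f bu.
have [x xP] := asymptotic_center hX bf.
by exists f, x; split => //; exact: weakly_cvg_asymptotic_center.
Qed.

End WeakCompactness.

(** * The weak and coconvex topologies *)

Lemma set_type_openP (T : topologicalType) (A : set T) (O : set (set_type A)) :
  open O <-> exists2 V : set T, open V & O = set_val @^-1` V.
Proof. by split=> [[V oV <-]|[V oV ->]]; exists V. Qed.

Lemma cvg_openP (T : topologicalType) (u : nat -> T) (x : T) : u @ \oo --> x <->
  forall V : set T, open V -> V x -> \forall n \near \oo, V (u n).
Proof.
split=> [ux V oV Vx|h W]; first by apply: ux; exact: open_nbhs_nbhs.
by rewrite nbhsE => -[V [oV Vx] VW]; apply: filterS VW _; exact: h.
Qed.

Lemma set_type_cvgP (T : topologicalType) (A : set T) (u : nat -> set_type A) (x : set_type A) :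
  u @ \oo --> x <-> (fun n => set_val (u n)) @ \oo --> (set_val x : T).
Proof.
split=> /cvg_openP ux; apply/cvg_openP.
  by move=> V oV Vx; apply: (ux (set_val @^-1` V)) => //; apply/set_type_openP; exists V.
by move=> _ /set_type_openP[V oV ->] Vx; exact: ux.
Qed.

Section WeakTopologies.
Context {R : realType} {X : metricType R}.
Implicit Types (x y z : X) (C F : set X) (u : nat -> X).

Lemma delta_closed_cofinal F u x (N : set nat) : delta_closed F ->
  mbounded (range u) -> weakly_cvg u x ->
  cofinal N -> (forall n, N n -> F (u n)) -> F x.
Proof.
move=> clF bu ux iN NF.
have ex k : exists n, N n /\ (k <= n)%N by have [n Nn kn] := iN k; exists n.
have [f fP] := choice ex.
apply: (clF (u \o f) x) => [n||].
- by apply: NF; case: (fP n).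
- exact: mbounded_subseq.
- by apply: weakly_cvg_subseq ux => n; case: (fP n).
Qed.

Lemma weakly_cvg_delta u x : mbounded (range u) -> weakly_cvg u x ->
  (u : nat -> delta_space X) @ \oo --> (x : delta_space X).
Proof.
move=> bu ux; apply/cvg_openP => V oV Vx; apply: contrapT => nV.
suff : (~` V) x by [].
apply: (delta_closed_cofinal (N := [set n | ~ V (u n)]) oV bu ux) => // k.
apply: contrapT => h; apply: nV; exists k => // n kn.
by apply: contrapT => Vn; apply: h; exists n.
Qed.

(** A subbase test for continuity; with [f] the identity it compares the coconvex topology with the
    metric and the weak one. *)
Lemma coconvex_preimage_open (T : topologicalType) (f : T -> coconvex_space X) :
  (forall C, closed C -> geod_convex C -> open (f @^-1` (~` C))) ->
  forall U : set (coconvex_space X), open U -> open (f @^-1` U).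
Proof.
move=> fC U [D' D'sub <-]; rewrite preimage_bigcup; apply: bigcup_open => A DA.
have [F Fsub <-] := D'sub A DA; rewrite preimage_bigcap openE => x xF.
apply: filter_bigI => V VF; apply: open_nbhs_nbhs; split; last exact: xF.
have [clV cV] : coconvex_subbase V by have := Fsub V VF; rewrite inE.
by rewrite -[V]setCK; exact: fC.
Qed.

Lemma coconvex_open_metric (U : set (coconvex_space X)) :
  open U -> open (U : set X).
Proof.
by apply: (@coconvex_preimage_open X id) => C clC _; exact: closed_openC.
Qed.

Lemma coconvex_open_delta (U : set (coconvex_space X)) : CAT0 X ->
  open U -> open (U : set (delta_space X)).
Proof.
move=> hX; apply: (@coconvex_preimage_open (delta_space X) id) => C clC cC.
have : delta_closed C by apply: midconvex_delta_closed => //; exact: geod_convex_midconvex.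
by rewrite -{1}[C]setCK.
Qed.

Lemma weakly_cvg_coconvex u x : CAT0 X -> mbounded (range u) ->
  weakly_cvg u x ->
  (u : nat -> coconvex_space X) @ \oo --> (x : coconvex_space X).
Proof.
move=> hX bu /(weakly_cvg_delta bu)/cvg_openP ux; apply/cvg_openP => V oV.
by apply: ux; exact: coconvex_open_delta.
Qed.

Lemma delta_closed1 x : CAT0 X -> delta_closed [set x].
Proof.
move=> hX; apply: midconvex_delta_closed => //.
  exact: accessible_closed_set1 (hausdorff_accessible (@metric_hausdorff _ X)) x.
move=> _ _ -> ->; exists x => // z; rewrite mdistxx expr0n/=; lra.
Qed.

Lemma mball_delta_closed x (r : R) : CAT0 X -> 0 <= r -> delta_closed (mball x r).
Proof.
move=> hX r0; apply: midconvex_delta_closed => //; last exact: mball_midconvex.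
apply/closed_mdistP => y h; apply/ler_addgt0Pr => e /h[z].
by rewrite /mball/= => xz yz; have := mdist_triangle x z y; rewrite (mdistC z y); lra.
Qed.

Lemma mball_mbounded x (r : R) u : (forall n, mball x r (u n)) -> mbounded (range u).
Proof.
move=> ur; exists (r + r) => _ _ [m _ <-] [n _ <-].
have := mdist_triangle (u m) x (u n); have := ur m; have := ur n.
rewrite /mball/= (mdistC (u m) x); lra.
Qed.

(** This yields uniqueness of limits in the weak topology without a Hausdorff assumption on it. *)
Lemma delta_limit_weak_limit u x z : CAT0 X -> mbounded (range u) ->
  (u : nat -> delta_space X) @ \oo --> (x : delta_space X) ->
  weakly_cvg u z -> x = z.
Proof.
move=> hX bu /cvg_openP ux uz; apply: contrapT => xz.
(* The terms different from [x], together with [z], form a Delta-closed set. *)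
pose A := [set a | a = z \/ a <> x /\ exists n, a = u n].
suff clA : delta_closed A.
  have [||N _ NP] := ux (~` A).
  - by rewrite /open/= /delta_open/= setCK.
  - by move=> [|[]].
  apply: xz; apply/esym.
  have clx : delta_closed [set x] by exact: delta_closed1.
  apply: (delta_closed_cofinal (N := [set n | (N <= n)%N]) clx bu uz).
    by move=> k; exists (maxn N k); rewrite /= ?leq_maxl ?leq_maxr.
  move=> n Nn; apply: contrapT => unx; apply: (NP n Nn).
  by right; split => //; exists n.
move=> w y wA bw wy; apply: contrapT => Ay.
(* A value [a] taken infinitely often would be the weak limit [y], and it lies in [A]. *)
have avoid a : \forall k \near \oo, w k <> a.
  apply: contrapT => na.
  have iN : cofinal [set k | w k = a].
    move=> k; apply: contrapT => h; apply: na; exists k => // n /= kn wna.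
    by apply: h; exists n.
  have [k wka _] := iN 0%N.
  have ya : y = a by apply: (delta_closed_cofinal (delta_closed1 (x := a) hX) bw wy iN).
  by apply: Ay; rewrite ya -wka.
have ex k : exists n, w k = z \/ w k = u n.
  by have [->|[_ [n ->]]] := wA k; [exists 0%N; left|exists n; right].
have [h hP] := choice ex.
(* Eventually [w] avoids [z] and the finitely many [u i] with [i < m]; so its indices tend to
   infinity and it inherits the weak limit [z]. *)
have hoo : h @ \oo --> \oo.
  suff avoidn m : \forall k \near \oo, (m <= h k)%N.
    by move=> S [m _ mS]; apply: filterS (avoidn m) => k /mS.
  have : \forall k \near \oo, forall i, (i < m)%N -> w k <> u i.
    elim: m => [|m IH]; first by exists 0%N.
    apply: filterS2 IH (avoid (u m)) => k IH wm i.
    by rewrite ltnS leq_eqVlt => /orP[/eqP ->//|]; exact: IH.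
  apply: filterS2 (avoid z) => k wz wu; rewrite leqNgt; apply/negP => hm.
  by have [|/(wu _ hm)] := hP k.
have wz : weakly_cvg w z.
  move=> l c gc c0; have := cvg_comp _ _ hoo (uz l c gc c0).
  apply: cvg_trans; apply: near_eq_cvg; apply: filterS (avoid z) => k wk /=.
  by have [|->] := hP k.
by apply: Ay; left; exact: weakly_cvg_unique hX wy wz.
Qed.

(** The coconvex topology is always the coarser one, and a nonempty bounded set lies in a ball
    around any of its points. *)
Lemma coincide_of_balls :
  (forall x (r : R), 0 <= r -> forall U : set (delta_space X), open U ->
    exists2 V : set (coconvex_space X), open V &
    forall y, mball x r y -> (U y <-> V y)) -> CAT0 X ->
  forall A : set X, mbounded A -> topologies_coincide_on A.
Proof.
move=> h hX A [M AM]; apply/seteqP; split=> O.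
  move=> /(@set_type_openP (coconvex_space X))[V oV ->].
  apply/(@set_type_openP (delta_space X)).
  by exists V => //; exact: coconvex_open_delta.
move=> /(@set_type_openP (delta_space X))[U oU ->].
apply/(@set_type_openP (coconvex_space X)).
have [[a Aa]|A0] := pselect (exists a, A a); last first.
  exists setT; first exact: openT.
  apply/seteqP; split => y _ //; exfalso.
  by apply: A0; exists (set_val y); exact: set_valP.
have M0 : 0 <= M by rewrite -(mdistxx a); exact: AM.
have [V oV UV] := h a M M0 U oU; exists V => //.
apply/seteqP; split => y /=; apply UV; apply: AM => //; exact: set_valP.
Qed.

(** A sequentially closed subset of the ball is Delta-closed, as weak limits are coconvex limits.
    Conversely, coincidence makes coconvex limits of [u] limits in the weak topology, so they all
    equal the weak limit of one subsequence. *)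
Lemma coincide_sequential x (r : R) : CAT0 X -> 0 <= r ->
  topologies_coincide_on (mball x r) ->
  sequential_space (coconvex_on (mball x r)) /\
  sequentially_hausdorff (coconvex_on (mball x r)).
Proof.
move=> hX r0 co; set B := mball x r in co *.
have bB (u : nat -> coconvex_on B) : mbounded (range (fun n => set_val (u n))).
  by apply: (@mball_mbounded x r) => n; exact: set_valP.
have cvgD (u : nat -> coconvex_on B) (y : coconvex_on B) : u @ \oo --> y ->
    ((fun n => set_val (u n)) : nat -> delta_space X) @ \oo --> (set_val y : delta_space X).
  move=> /cvg_openP uy; apply/(@set_type_cvgP (delta_space X))/cvg_openP => V oV.
  by apply: uy; rewrite co.
split=> [A seqA|u y z uy uz].
  rewrite -[A]setCK; apply: open_closedC; rewrite co.
  apply/(@set_type_openP (delta_space X)); exists (~` (set_val @` A)); last first.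
    apply/seteqP; split => y /=.
      by move=> Ay [z Az /val_inj zy]; apply: Ay; rewrite -zy.
    by move=> Ay Ay'; apply: Ay; exists y.
  rewrite /open/= /delta_open/= setCK => u y uA bu uy.
  have ex n : exists v, A v /\ set_val v = u n by have [v] := uA n; exists v.
  have [v vP] := choice ex.
  have By : B y.
    by apply: (mball_delta_closed hX r0 _ bu uy) => n; have [_ <-] := vP n; exact: set_valP.
  exists (exist _ y (mem_set By)); last by [].
  apply: (seqA v) => [n|]; first by have [] := vP n.
  apply/(@set_type_cvgP (coconvex_space X)) => /=.
  have -> : (fun n => set_val (v n)) = u by apply/funext => n; have [] := vP n.
  exact: weakly_cvg_coconvex.
have [f [w [fge uw]]] := weak_sequential_compactness hX (bB u).
have bf := mbounded_subseq f (bB u).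
have lim t : u @ \oo --> t -> set_val t = w.
  move=> /cvgD ut; apply: delta_limit_weak_limit hX bf _ uw.
  exact: cvg_comp (cvg_nat_ge fge) ut.
by apply: val_inj; exact: etrans (lim y uy) (esym (lim z uz)).
Qed.

Lemma sequential_coincide x (r : R) : CAT0 X -> 0 <= r ->
  sequential_space (coconvex_on (mball x r)) ->
  sequentially_hausdorff (coconvex_on (mball x r)) ->
  forall U : set (delta_space X), open U ->
    exists2 V : set (coconvex_space X), open V &
    forall y, mball x r y -> (U y <-> V y).
Proof.
move=> hX r0 sB hB U oU; set B := mball x r in sB hB *.
pose A : set (coconvex_on B) := set_val @^-1` (~` U).
suff /closed_openC/(@set_type_openP (coconvex_space X))[V oV AV] : closed A.
  exists V => // y By; have /= -> := congr1 (fun S => S (exist _ y (mem_set By))) (esym AV).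
  by rewrite /A/= notK.
apply: sB => u y uA uy.
have uB n : B (set_val (u n)) by exact: set_valP.
have bu := mball_mbounded uB.
have [f [w [fge uw]]] := weak_sequential_compactness hX bu.
have bf := mbounded_subseq f bu.
have Bw : B w by apply: (mball_delta_closed hX r0 _ bf uw) => n; exact: uB.
have Uw : (~` U) w by apply: (oU _ _ _ bf uw) => n; exact: uA.
have -> : y = exist _ w (mem_set Bw); last exact: Uw.
apply: (hB (u \o f)); first exact: cvg_comp (cvg_nat_ge fge) uy.
by apply/(@set_type_cvgP (coconvex_space X)); exact: weakly_cvg_coconvex.
Qed.

End WeakTopologies.

(** * Hausdorff balls *)

(** Finite trees labelled by natural numbers serve as formal terms in the operations [f n]; they are
    countable, and [s] enumerates their values. *)
Lemma countable_operation_closure (T : Type) (x0 : T) (f : nat -> seq T -> T) :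
  exists s : nat -> T, forall n (js : seq nat), exists m, s m = f n (map s js).
Proof.
pose eval := fix eval (t : GenTree.tree nat) :=
  match t with GenTree.Leaf _ => x0 | GenTree.Node n ts => f n (map eval ts) end.
pose term j : GenTree.tree nat := odflt (GenTree.Leaf 0%N) (unpickle j).
exists (eval \o term) => n js; exists (pickle (GenTree.Node n (map term js))).
by rewrite /= /term pickleK /= -map_comp.
Qed.

Lemma hausdorff_separation (T : topologicalType) (x y : T) :
  hausdorff_space T -> x <> y ->
  exists U V : set T, [/\ open U, open V, U x, V y & U `&` V = set0].
Proof.
rewrite open_hausdorff => hT /eqP /hT[[U V] /=].
by rewrite !inE => -[Ux Vy] [oU oV UV]; exists U, V; split => //.
Qed.

Section HausdorffBalls.
Context {R : realType} {X : metricType R}.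
Implicit Types (x y z : X).

Lemma closure_midconvex (A : set X) : CAT0 X ->
  (forall a b, A a -> A b -> exists2 m, A m & cat0_midpoint a b m) ->
  midconvex (closure A).
Proof.
move=> hX mA a b Aa Ab; have [m abm] := midpoint_exists a b hX.
exists m => //; apply: (closed_mdistP (closure A)).1; first exact: closed_closure.
move=> e e0.
have cl y d : closure A y -> 0 < d -> exists2 w, A w & mdist y w < d.
  move=> Ay d0; have [|w [Aw yw]] := Ay [set w | mdist y w < d]; last by exists w.
  by apply/metricType_numDomainType.nbhs_mdistP; exists d.
set D := mdist a b; have D0 : 0 <= D by exact: mdist_ge0.
(* The inequality for [m'] at the point [m] bounds [mdist m m' ^+ 2] by [2 * D * d + d ^+ 2], which
   this [d] makes smaller than [e ^+ 2]. *)
pose d := Num.min 1 (e ^+ 2 / (4 * (2 * D + 1))).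
have D1 : 0 < 4 * (2 * D + 1) by lra.
have d0 : 0 < d by rewrite lt_min ltr01/= divr_gt0// exprn_gt0.
have d1 : d <= 1 by rewrite ge_min lexx.
have d2 : d * (4 * (2 * D + 1)) <= e ^+ 2.
  by rewrite -ler_pdivlMr// ge_min lexx orbT.
have [a' Aa' aa'] := cl a d Aa d0; have [b' Ab' bb'] := cl b d Ab d0.
have [m' Am' abm'] := mA _ _ Aa' Ab'; exists m'; first exact: subset_closure.
rewrite -(@ltr_pXn2r _ 2%N)// ?nnegrE ?mdist_ge0// ?ltW//.
have ma := midpoint_distl abm; have mb := midpoint_distl (midpoint_sym abm).
rewrite (mdistC a m) -/D in ma; rewrite (mdistC b m) (mdistC b a) -/D in mb.
have h1 := mdist_triangle m a a'; have h2 := mdist_triangle m b b'.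
have h3 := mdist_triangle a a' b; have h4 := mdist_triangle a' b' b.
rewrite -/D in h3; rewrite (mdistC b' b) in h4.
have ma2 : mdist m a' ^+ 2 <= (D / 2 + d) ^+ 2.
  by rewrite ler_pXn2r ?nnegrE ?mdist_ge0//; lra.
have mb2 : mdist m b' ^+ 2 <= (D / 2 + d) ^+ 2.
  by rewrite ler_pXn2r ?nnegrE ?mdist_ge0//; lra.
have ab2 : D ^+ 2 - 4 * D * d <= mdist a' b' ^+ 2.
  have [Dd|dD] := leP D (2 * d).
    by have := sqr_ge0 (mdist a' b'); nra.
  have : (D - 2 * d) ^+ 2 <= mdist a' b' ^+ 2.
    by rewrite ler_pXn2r ?nnegrE ?mdist_ge0//; lra.
  by have := sqr_ge0 d; lra.
have dd : d ^+ 2 <= d by rewrite expr2 ger_pMl.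
by have := abm' m; have := exprn_gt0 2 e0; nra.
Qed.

Lemma hausdorff_coincide x (r : R) : CAT0 X -> 0 <= r ->
  hausdorff_space (coconvex_on (mball x r)) ->
  forall U : set (delta_space X), open U ->
    exists2 V : set (coconvex_space X), open V &
    forall y, mball x r y -> (U y <-> V y).
Proof.
move=> hX r0; set B := mball x r => hB U oU.
pose T := coconvex_on B.
pose A : set T := set_val @^-1` (~` U).
suff /closed_openC/(@set_type_openP (coconvex_space X))[V oV AV] : closed A.
  exists V => // y By; have /= -> := congr1 (fun S => S (exist _ y (mem_set By))) (esym AV).
  by rewrite /A/= notK.
move=> w clAw; apply: contrapT => nAw.
(* [p] encodes a metric ball, which is good if it can be separated from [w];
   then [S p] separates it. *)
pose good (p : X * nat) (UV : set T * set T) :=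
  [/\ open UV.2, UV.1 `&` UV.2 = set0 &
    forall y : T, mdist p.1 (set_val y) < p.2.+1%:R^-1 -> UV.2 y].
(* A ball that cannot be separated receives [(setT, setT)], so [S] is total and its first components
   are always neighborhoods of [w]. *)
have sep (p : X * nat) : exists UV : set T * set T, nbhs w UV.1 /\
    ((exists2 UV', nbhs w UV'.1 & good p UV') -> good p UV).
  have [[UV wU gUV]|ng] := pselect (exists2 UV', nbhs w UV'.1 & good p UV').
    by exists UV.
  by exists (setT, setT); split => //=; exact: filterT.
have [S SP] := choice sep.
have pick (ps : seq (X * nat)) : exists y : T,
    A y /\ forall p, p \in ps -> (S p).1 y.
  have : nbhs w [set y | forall p, p \in ps -> (S p).1 y].
    elim: ps => [|p ps IH]; first by apply: filterS filterT => y _ p; rewrite in_nil.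
    have [wp _] := SP p; apply: filterS2 IH wp => y IH yp q.
    by rewrite in_cons => /predU1P[->//|]; exact: IH.
  by move=> /clAw[y [Ay yp]]; exists y.
have [phi phiP] := choice pick.
have [mid midP] := choice (fun p : X * X => midpoint_exists p.1 p.2 hX).
(* Operation [0] takes midpoints; operation [k.+1] receives the centers as arguments and decodes the
   radii from [k]. *)
pose f n (xs : seq X) := if n is k.+1
  then set_val (phi (zip xs (CodeSeq.decode k)))
  else mid (nth (set_val w) xs 0, nth (set_val w) xs 1).
have [s sP] := @countable_operation_closure X (set_val w) f.
have smid a b : range s a -> range s b -> exists2 m, range s m & cat0_midpoint a b m.
  move=> [i _ <-] [j _ <-]; have [m mE] := sP 0%N [:: i; j].
  by exists (s m); [exists m|rewrite mE; exact: midP].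
pose pairs := map (fun ij : nat * nat => (s ij.1, ij.2)).
have sphi ps : range s (set_val (phi (pairs ps))).
  have [m mE] := sP (CodeSeq.code (unzip2 ps)).+1 (unzip1 ps); exists m => //.
  rewrite mE /= CodeSeq.codeK; congr (set_val (phi _)).
  by rewrite /pairs; elim: ps {m mE} => //= -[i j] ps ->.
pose e n : nat * nat := odflt (0, 0)%N (unpickle n).
(* [d n] meets the constraints of the first [n] coded balls, so each ball with center in [range s]
   constrains all late terms. *)
pose d n : T := phi (pairs (map e (iota 0 n))).
have dB n : B (set_val (d n)) by exact: set_valP.
have bd := mball_mbounded dB.
have [g [z [gge dz]]] := weak_sequential_compactness hX bd.
have bdg := mbounded_subseq g bd.
have Bz : B z by apply: (mball_delta_closed hX r0 _ bdg dz) => n; exact: dB.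
have Uz : (~` U) z.
  by apply: (oU _ _ _ bdg dz) => n; have [] := phiP (pairs (map e (iota 0 (g n)))).
have sz : closure (range s) z.
  have clS : delta_closed (closure (range s)).
    by apply: midconvex_delta_closed => //; [exact: closed_closure|exact: closure_midconvex].
  apply: (clS _ _ _ bdg dz).
  by move=> n; apply: subset_closure; exact: sphi.
pose z' : T := exist _ z (mem_set Bz).
have wz : w <> z' by move=> wz; apply: nAw; rewrite wz.
have [U' [V' [oU' oV' U'w V'z UV']]] := hausdorff_separation hB wz.
have /(@set_type_openP (coconvex_space X))[W oW V'E] := oV'.
have Wz : W z by rewrite V'E in V'z.
have : nbhs z (W : set X).
  by apply: open_nbhs_nbhs; split => //; exact: coconvex_open_metric.
move=> /metricType_numDomainType.nbhs_mdistP[eps /= eps0 epsW].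
(* Half of [eps] for the radius and half for the distance from [z] to the center [s i] put the ball
   inside [W]. *)
have eps20 : 0 < eps / 2 by rewrite divr_gt0.
have [k ke] := ltr_add_invr eps20; rewrite add0r in ke.
have k0 : 0 < k.+1%:R^-1 :> R by rewrite invr_gt0.
have [|_ [[i _ <-] zi]] := sz [set y | mdist z y < k.+1%:R^-1].
  by apply/metricType_numDomainType.nbhs_mdistP; exists k.+1%:R^-1.
have [_ []] := SP (s i, k).
  exists (U', V') => /=; first exact: open_nbhs_nbhs.
  split; [exact: oV'|exact: UV'|move=> y iy].
  rewrite V'E; apply: epsW => /=.
  apply: le_lt_trans (mdist_triangle z (s i) _) _; rewrite (splitr eps).
  by apply: ltrD; apply: lt_trans ke; [exact: zi|exact: iy].
move=> oV UV NV.
have Vz : (S (s i, k)).2 z' by apply: NV; rewrite /= mdistC.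
have dz' : (d \o g) @ \oo --> z'.
  by apply/(@set_type_cvgP (coconvex_space X)); exact: weakly_cvg_coconvex.
have /cvg_openP/(_ _ oV Vz)[N _ NP] := dz'.
(* Beyond [N] the terms [d (g n)] lie in the second set of the pair; past the code of [(i, k)] they
   lie in the first. *)
pose n := maxn N (pickle (i, k)).+1.
suff Ud : (S (s i, k)).1 (d (g n)).
  suff : ((S (s i, k)).1 `&` (S (s i, k)).2) (d (g n)) by rewrite UV.
  by split => //; apply: NP => /=; exact: leq_maxl.
have [_] := phiP (pairs (map e (iota 0 (g n)))); apply.
apply/mapP; exists (i, k) => //; apply/mapP; exists (pickle (i, k)).
  by rewrite mem_iota /= add0n (leq_trans _ (gge n))// leq_maxr.
by rewrite /e pickleK.
Qed.

End HausdorffBalls.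

Theorem proposition6p1 (R : realType) (X : metricType R) (hX : CAT0 X) :
  ((forall A : set X, mbounded A -> topologies_coincide_on A) <->
   (forall (x : X) (r : R), 0 <= r ->
      sequential_space (coconvex_on (mball x r)) /\
      sequentially_hausdorff (coconvex_on (mball x r)))) /\
  ((forall (x : X) (r : R), 0 <= r ->
      hausdorff_space (coconvex_on (mball x r))) ->
   (forall A : set X, mbounded A -> topologies_coincide_on A)).
Proof.
split; [split=> [co x r r0|h]|move=> h].
- apply: coincide_sequential => //; apply: co.
  exists (r + r) => a b; rewrite /mball/= => xa xb.
  by have := mdist_triangle a x b; rewrite (mdistC a x); lra.
- apply: coincide_of_balls => // x r r0.
  by have [] := h x r r0; exact: sequential_coincide.
- apply: coincide_of_balls => // x r r0.
  by apply: hausdorff_coincide => //; exact: h.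
Qed.
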